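(* Let $n$ be a positive integer and let $Q_n$ be the $n$-dimensional hypercube. Then $edim(Q_n)\le n$.
   Context: All graphs are finite and simple. The hypercube $Q_n$ has as vertices the $2^n$ vectors of length $n$ with coordinates in $\{0,1\}$, two of them being adjacent whenever they differ in exactly one coordinate. For a connected graph $G=(V,E)$, $d_G(x,y)$ is the length of a shortest path between vertices $x,y$. The distance between a vertex $v$ and an edge $e=uw$ is $d_G(e,v)=\min\{d_G(u,v),d_G(w,v)\}$. A vertex $w$ distinguishes two edges $e_1,e_2$ if $d_G(w,e_1)\ne d_G(w,e_2)$. A set $S\subseteq V$ is an edge metric generator for $G$ if every two distinct edges of $G$ are distinguished by some vertex of $S$; the edge metric dimension $edim(G)$ is the smallest cardinality of an edge metric generator for $G$. *)

(* Defs.v *)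
From mathcomp Require Import all_boot.

Set Implicit Arguments.
Unset Strict Implicit.
Unset Printing Implicit Defensive.

(* A finite simple graph is a symmetric irreflexive relation e on a finType. *)

Section GraphDefs.

Variables (T : finType) (e : rel T).

Definition has_walk (x y : T) (k : nat) : bool :=
  [exists p : k.-tuple T, path e x p && (last x p == y)].

(* A shortest path has fewer than #|T| edges, so bounding k loses nothing;
   #|T| is the value when no path exists (see gdist_le and gdist_path). *)
Definition gdist (x y : T) : nat :=
  \big[minn/#|T|]_(k < #|T| | has_walk x y k) k.

Definition edges : {set {set T}} :=
  [set [set u.1; u.2] | u : T * T & e u.1 u.2].

(* The default #|T| bounds gdist, hence is irrelevant for a nonempty f
   (see edge_dist2). *)
Definition edge_dist (f : {set T}) (v : T) : nat :=
  \big[minn/#|T|]_(u in f) gdist u v.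

Definition distinguishes (w : T) (f1 f2 : {set T}) : bool :=
  edge_dist f1 w != edge_dist f2 w.

Definition edge_metric_generator (S : {set T}) : bool :=
  [forall f1 in edges, forall f2 in edges,
     (f1 != f2) ==> [exists w in S, distinguishes w f1 f2]].

(* [set: T] is always a generator (setT_generator), as arg min requires. *)
Definition edim : nat :=
  #|[arg min_(S < [set: T] | edge_metric_generator S) #|S|]|.

End GraphDefs.

Definition hypercube (n : nat) : rel (n.-tuple bool) :=
  fun x y => #|[set i : 'I_n | tnth x i != tnth y i]| == 1.

Section GraphFacts.

Variables (T : finType) (e : rel T).

Lemma bigminn_le (I : finType) (P : pred I) (F : I -> nat) m i :
  P i -> \big[minn/m]_(j | P j) F j <= F i.
Proof.
move=> Pi; rewrite -big_filter.
have : i \in [seq j <- index_enum I | P j] by rewrite mem_filter Pi mem_index_enum.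
elim: [seq _ <- _ | _] => // j s IHs; rewrite inE big_cons geq_min.
by case/orP=> [/eqP->|/IHs->]; rewrite ?leqnn ?orbT.
Qed.

Lemma bigminn_le_id (I : finType) (P : pred I) (F : I -> nat) m :
  \big[minn/m]_(j | P j) F j <= m.
Proof.
by elim/big_rec: _ => // i k _ lekm; rewrite geq_min lekm orbT.
Qed.

Lemma bigminn_attained (I : finType) (P : pred I) (F : I -> nat) m :
  \big[minn/m]_(j | P j) F j = m \/
  exists2 i, P i & \big[minn/m]_(j | P j) F j = F i.
Proof.
elim/big_rec: _ => [|i k Pi IH]; first by left.
by rewrite minnC /minn; case: ifP => // _; right; exists i.
Qed.

Lemma gdist_le_card x y : gdist e x y <= #|T|.
Proof. exact: bigminn_le_id. Qed.

Lemma gdist_le x p : path e x p -> gdist e x (last x p) <= size p.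
Proof.
move=> ep; case: (ltnP (size p) #|T|) => [ltp|]; last first.
  exact: leq_trans (gdist_le_card _ _).
apply: (@bigminn_le _ _ (fun k : 'I_#|T| => k : nat) _ (Ordinal ltp)).
by apply/existsP; exists (in_tuple p); rewrite ep eqxx.
Qed.

Lemma gdist_path x y : connect e x y ->
  exists p, [/\ path e x p, y = last x p & size p = gdist e x y].
Proof.
case/connectP=> p0 /shortenP[p ep up _ def_y].
have ltp: size p < #|T| by rewrite -[size p < _]/(size (x :: p) <= _) -(card_uniqP up) max_card.
have := gdist_le ep; rewrite -def_y => le_d.
case: (@bigminn_attained 'I_#|T| (fun k => has_walk e x y k) (fun k : 'I_#|T| => k : nat) #|T|).
  by rewrite -/(gdist e x y) => Ed; rewrite Ed leqNgt ltp in le_d.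
case=> k /existsP[q /andP[eq_ /eqP lq]] Ed.
by exists q; split; rewrite ?lq ?size_tuple /gdist ?Ed.
Qed.

Lemma gdist_eq0 x y : (gdist e x y == 0) = (x == y).
Proof.
apply/eqP/eqP=> [|<-]; last first.
  by apply/eqP; rewrite -leqn0; apply: (@gdist_le x [::]).
case: (@bigminn_attained 'I_#|T| (fun k => has_walk e x y k) (fun k : 'I_#|T| => k : nat) #|T|).
  by rewrite /gdist => -> T0; have := card0_eq T0 x; rewrite inE.
case=> k /existsP[q /andP[_ /eqP<-]]; rewrite /gdist => -> k0.
by move: q; rewrite k0 => q; rewrite tuple0.
Qed.

Lemma edge_dist2 u w v :
  edge_dist e [set u; w] v = minn (gdist e u v) (gdist e w v).
Proof.
apply/eqP; rewrite eqn_leq leq_min -andbA; apply/and3P; split.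
- by apply: (@bigminn_le _ _ (fun x => gdist e x v)); rewrite !inE eqxx.
- by apply: (@bigminn_le _ _ (fun x => gdist e x v)); rewrite !inE eqxx orbT.
have [Ed|[x + Ed]] := bigminn_attained (mem [set u; w]) (fun x => gdist e x v) #|T|.
  by rewrite /edge_dist Ed geq_min gdist_le_card.
by rewrite /edge_dist Ed !inE => /orP[]/eqP->; rewrite geq_min leqnn ?orbT.
Qed.

Lemma edge_dist_eq0 f v : (edge_dist e f v == 0) = (v \in f).
Proof.
apply/idP/idP=> [/eqP d0|fv]; last first.
  rewrite -leqn0 -(eqP (_ : gdist e v v == 0)) ?gdist_eq0 //.
  exact: (@bigminn_le _ _ (fun x => gdist e x v)).
have [Ed|[x fx Ed]] := bigminn_attained (mem f) (fun x => gdist e x v) #|T|.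
  by move: d0; rewrite /edge_dist Ed => T0; have := card0_eq T0 v; rewrite inE.
by move/eqP: d0; rewrite /edge_dist Ed gdist_eq0 => /eqP <-.
Qed.

Lemma setT_generator : edge_metric_generator e [set: T].
Proof.
apply/forall_inP=> f1 _; apply/forall_inP=> f2 _; apply/implyP.
apply: contraR => /exists_inPn nd; apply/eqP/setP=> v.
have := nd v (in_setT v); rewrite negbK => /eqP Ed.
by rewrite -!edge_dist_eq0 Ed.
Qed.

Lemma edim_le S : edge_metric_generator e S -> edim e <= #|S|.
Proof.
by rewrite /edim; case: arg_minnP => [|S0 _ min_S0 /min_S0//]; apply: setT_generator.
Qed.

Lemma edim_attained : exists2 S, edge_metric_generator e S & #|S| = edim e.
Proof.
by rewrite /edim; case: arg_minnP => [|S0 gS0 _]; [apply: setT_generator | exists S0].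
Qed.

End GraphFacts.

Lemma hypercube_sym n : symmetric (@hypercube n).
Proof.
by move=> x y; congr (#|pred_of_set _| == 1); apply/setP=> i; rewrite !inE eq_sym.
Qed.

Lemma hypercube_irrefl n : irreflexive (@hypercube n).
Proof.
move=> x; rewrite /hypercube (_ : [set i | _] = set0) ?cards0 //.
by apply/setP=> i; rewrite !inE eqxx.
Qed.

Lemma hypercube_connected n (x y : n.-tuple bool) : connect (@hypercube n) x y.
Proof.
have [k] := ubnP #|[set i | tnth x i != tnth y i]|.
elim: k x => // k IHk x lt_k.
have [D0|[i]] := set_0Vmem [set i | tnth x i != tnth y i].
  rewrite (_ : x = y) //; apply: eq_from_tnth => i.
  by apply/eqP; have := in_set0 i; rewrite -D0 inE => /negbFE.
rewrite inE => ne_i.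
pose z := [tuple if j == i then tnth y i else tnth x j | j < n].
have xz: hypercube x z.
  apply/cards1P; exists i; apply/setP=> j; rewrite !inE tnth_mktuple.
  by case: (eqVneq j i) => [->|_]; rewrite ?eqxx // ne_i.
apply: connect_trans (connect1 xz) (IHk _ _).
rewrite -ltnS; apply: leq_trans lt_k; rewrite ltnS.
apply: proper_card; apply/properP; split.
  by apply/subsetP=> j; rewrite !inE tnth_mktuple; case: (eqVneq j i) => // ->; rewrite eqxx.
by exists i; rewrite !inE // tnth_mktuple !eqxx.
Qed.

(* Main.v *)
Require Import Defs.
From mathcomp Require Import all_boot zify.

(** An edge [uw] of the hypercube is known once the coordinatewise sums
    [u_i + w_i] in {0, 1, 2} are: the value 1 marks the direction of the edge,
    0 and 2 give the coordinates shared by its ends ([edge_eq_of_coord_sums]).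

    These sums are linear data.  The distance in the hypercube is the Hamming
    distance ([gdist_hypercube]), and for a vertex [v] the distances of [v] to
    [u] and to [w] differ by exactly 1, so that the distance from [v] to the
    edge carries the same information as the sum s(v) of these two distances
    ([hamming_adjacent]).  When one coordinate of [v] is switched from 0 to 1, s(v)
    changes by [2 - 2 (u_i + w_i)].  Along the path of vertices
    1^k 0^(n-k), for k = 0, ..., n, every coordinate is switched exactly once,
    so these n + 1 vertices recover all the sums.  The last of them can be
    left out: it is antipodal to the first, and the values of s at antipodal
    vertices add up to 2n ([hamming_antipode]).  Hence the n vertices
    1^k 0^(n-k) with k < n form an edge metric generator. *)

Definition hamming {n : nat} (x y : n.-tuple bool) : nat :=
  \sum_(i < n) (tnth x i != tnth y i).

Lemma hypercubeE n (x y : n.-tuple bool) : hypercube x y = (hamming x y == 1).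
Proof. by rewrite /hypercube /hamming -sum1dep_card big_mkcond. Qed.

Lemma hammingxx n (x : n.-tuple bool) : hamming x x = 0.
Proof. by apply: big1 => i _; rewrite eqxx. Qed.

Lemma hamming_triangle n (x y z : n.-tuple bool) :
  hamming x z <= hamming x y + hamming y z.
Proof.
rewrite /hamming -big_split /=; apply: leq_sum => i _.
by case: (tnth x i) (tnth y i) (tnth z i) => [] [] [].
Qed.

Lemma hamming_le_size n (x : n.-tuple bool) p :
  path (@hypercube n) x p -> hamming x (last x p) <= size p.
Proof.
elim: p x => [|y p IHp] x /=; first by rewrite hammingxx.
rewrite hypercubeE => /andP[/eqP xy /IHp le_p].
by apply: leq_trans (hamming_triangle _ _ y _) _; rewrite xy.
Qed.

(** Correcting the differing coordinates one at a time gives a geodesic. *)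
Lemma hamming_path n (x y : n.-tuple bool) :
  exists2 p, path (@hypercube n) x p /\ last x p = y & size p = hamming x y.
Proof.
move Ek: (hamming x y) => k; elim: k x Ek => [|k IHk] x Ek.
  exists [::] => //; split=> //; apply: eq_from_tnth => i.
  by apply/eqP; move: Ek; rewrite /hamming (bigD1 i) //=; case: eqP.
have /existsP[i ne_i]: [exists i, tnth x i != tnth y i].
  apply: contraT => /existsPn eq_xy; move: Ek; rewrite /hamming big1 // => i _.
  by rewrite (negbTE (eq_xy i)).
pose z := [tuple if j == i then tnth y i else tnth x j | j < n].
have z_i: tnth z i = tnth y i by rewrite tnth_mktuple eqxx.
have z_j j : j != i -> tnth z j = tnth x j.
  by rewrite tnth_mktuple => /negbTE ->.
have xz: hypercube x z.
  rewrite hypercubeE /hamming (bigD1 i) //= z_i ne_i big1 // => j /z_j ->.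
  by rewrite eqxx.
have zy: hamming z y = k.
  move: Ek; rewrite /hamming (bigD1 i) //= ne_i => -[<-].
  rewrite (bigD1 i) //= z_i eqxx add0n.
  by apply: eq_bigr => j /z_j ->.
have [p [zp zpy] sz_p] := IHk z zy.
by exists (z :: p); rewrite /= ?xz ?sz_p.
Qed.

Lemma gdist_hypercube n (x y : n.-tuple bool) :
  gdist (@hypercube n) x y = hamming x y.
Proof.
apply/eqP; rewrite eqn_leq; apply/andP; split.
  by have [p [xp <-] <-] := hamming_path _ x y; apply: gdist_le.
have [p [xp -> <-]] := gdist_path (hypercube_connected x y).
exact: hamming_le_size.
Qed.

Lemma hypercube_flip n (u w : n.-tuple bool) : hypercube u w ->
  exists2 i, tnth w i = ~~ tnth u i & forall j, j != i -> tnth w j = tnth u j.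
Proof.
case/cards1P=> i /setP Di; exists i.
  by move: (Di i); rewrite !inE eqxx; case: (tnth u i) (tnth w i) => [] [].
move=> j /negbTE ne_ji; move: (Di j); rewrite !inE ne_ji.
by case: (tnth u j) (tnth w j) => [] [].
Qed.

(** The two terms differ by exactly one, the contribution of the coordinate in
    which the ends of the edge differ; so their minimum determines their sum,
    which, unlike the minimum, is a sum over coordinates. *)
Lemma hamming_adjacent n (u w v : n.-tuple bool) : hypercube u w ->
  hamming u v + hamming w v = (minn (hamming u v) (hamming w v)).*2.+1.
Proof.
case/hypercube_flip=> i w_i w_j; rewrite /hamming !(bigD1 i (P := xpredT)) //= w_i.
have -> : \sum_(j < n | j != i) (tnth w j != tnth v j) =
          \sum_(j < n | j != i) (tnth u j != tnth v j).
  by apply: eq_bigr => j /w_j ->.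
by move: (bigop _ _ _) => S; case: (tnth u i) (tnth v i) => [] [] /=; lia.
Qed.

Lemma hamming_antipode n (x v : n.-tuple bool) :
  hamming x v + hamming x (map_tuple negb v) = n.
Proof.
rewrite /hamming -big_split /= -[RHS]card_ord -sum1_card.
by apply: eq_bigr => i _; rewrite tnth_map; case: (tnth x i) (tnth v i) => [] [].
Qed.

Lemma edge_eq_of_coord_sums n (u w u' w' : n.-tuple bool) :
    hypercube u w -> hypercube u' w' ->
    (forall i, tnth u i + tnth w i = tnth u' i + tnth w' i) ->
  [set u; w] = [set u'; w'].
Proof.
case/hypercube_flip=> i w_i w_j; case/hypercube_flip=> i' w'_i w'_j sum_eq.
have {i' w'_i w'_j} [w'_i w'_j]: tnth w' i = ~~ tnth u' i
    /\ forall j, j != i -> tnth w' j = tnth u' j.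
  (* Otherwise the sum at i would be 1 for the first edge, even for the second. *)
  have [->|ne_ii'] := eqVneq i i'; first by [].
  move: (sum_eq i); rewrite w_i w'_j //.
  by case: (tnth u i) (tnth u' i) => [] [].
have eq_j j : j != i -> tnth u j = tnth u' j.
  move=> ne_ji; move: (sum_eq j); rewrite w_j // w'_j //.
  by case: (tnth u j) (tnth u' j) => [] [].
have [eq_i|ne_i] := eqVneq (tnth u i) (tnth u' i).
  suff [-> ->]: u = u' /\ w = w' by [].
  split; apply: eq_from_tnth => j; have [->|ne_ji] := eqVneq j i => //.
  - exact: eq_j.
  - by rewrite w_i w'_i eq_i.
  - by rewrite w_j // w'_j // eq_j.
suff [-> ->]: u = w' /\ w = u' by rewrite setUC.
split; apply: eq_from_tnth => j; have [->|ne_ji] := eqVneq j i => //.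
- by rewrite w'_i; case: (tnth u i) (tnth u' i) ne_i => [] [].
- by rewrite w'_j // eq_j.
- by rewrite w_i; case: (tnth u i) (tnth u' i) ne_i => [] [].
- by rewrite w_j // eq_j.
Qed.

Definition ones_prefix (n k : nat) : n.-tuple bool := [tuple i < k | i < n].

(** Consecutive prefixes differ in coordinate [i] only, which makes the
    distance go up or down according to the value of [x] there. *)
Lemma hamming_ones_prefixS n (x : n.-tuple bool) (i : 'I_n) :
  hamming x (ones_prefix n i.+1) + tnth x i =
  hamming x (ones_prefix n i) + ~~ tnth x i.
Proof.
rewrite /hamming !(bigD1 i (P := xpredT)) //= !tnth_mktuple ltnSn ltnn.
have -> : \sum_(j < n | j != i) (tnth x j != tnth (ones_prefix n i.+1) j) =
          \sum_(j < n | j != i) (tnth x j != tnth (ones_prefix n i) j).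
  apply: eq_bigr => j; rewrite !tnth_mktuple ltnS leq_eqVlt.
  by rewrite -[X in ~~ X]/(j == i :> nat) => /negbTE ->.
by move: (bigop _ _ _) => S; case: (tnth x i) => /=; lia.
Qed.

Lemma antipode_ones_prefix0 n :
  map_tuple negb (ones_prefix n 0) = ones_prefix n n.
Proof.
by apply: eq_from_tnth => i; rewrite tnth_map !tnth_mktuple ltn_ord.
Qed.

Lemma edge_dist_ones_prefix_inj n (u w u' w' : n.-tuple bool) :
    hypercube u w -> hypercube u' w' ->
    (forall k, k < n ->
       edge_dist (@hypercube n) [set u; w] (ones_prefix n k) =
       edge_dist (@hypercube n) [set u'; w'] (ones_prefix n k)) ->
  [set u; w] = [set u'; w'].
Proof.
move=> uw uw' eq_dist.
pose s (a b : n.-tuple bool) k :=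
  hamming a (ones_prefix n k) + hamming b (ones_prefix n k).
have eq_s_lt k : k < n -> s u w k = s u' w' k.
  move=> /eq_dist; rewrite !edge_dist2 !gdist_hypercube => eq_min.
  by rewrite /s !hamming_adjacent // eq_min.
(* At k = n the prefix is antipodal to the one at k = 0, which belongs to the
   family. *)
have eq_s k : k <= n -> s u w k = s u' w' k.
  rewrite leq_eqVlt => /predU1P[-> | /eq_s_lt //].
  have n_gt0: 0 < n.
    by have [i _ _] := hypercube_flip _ _ _ uw; apply: leq_ltn_trans (ltn_ord i).
  have /= := eq_s_lt 0 n_gt0; rewrite /s.
  have anti x := hamming_antipode n x (ones_prefix n 0).
  rewrite antipode_ones_prefix0 in anti.
  by move: (anti u) (anti w) (anti u') (anti w'); lia.
(* The increments of s from i to i + 1 give the coordinate sums at i. *)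
apply: edge_eq_of_coord_sums => // i.
have eq_i := eq_s i (ltnW (ltn_ord i)); have eq_i1 := eq_s i.+1 (ltn_ord i).
have step x := hamming_ones_prefixS n x i.
move: (step u) (step w) (step u') (step w') eq_i eq_i1; rewrite /s.
by case: (tnth u i) (tnth w i) (tnth u' i) (tnth w' i) => [] [] [] [] /=; lia.
Qed.

Lemma ones_prefix_generator n :
  edge_metric_generator (@hypercube n) [set ones_prefix n k | k : 'I_n].
Proof.
apply/forall_inP=> _ /imsetP[[u w] /= uw ->].
apply/forall_inP=> _ /imsetP[[u' w'] /= uw' ->]; rewrite !inE /= in uw uw'.
apply/implyP; apply: contraR => /exists_inPn nd; apply/eqP.
apply: edge_dist_ones_prefix_inj => // k lt_kn.
by apply/eqP; apply/negPn; apply: nd; apply/imsetP; exists (Ordinal lt_kn).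
Qed.

Theorem theorem26 (n : nat) (hn : 0 < n) : edim (@hypercube n) <= n.
Proof.
apply: leq_trans (edim_le (ones_prefix_generator n)) _.
by rewrite -[leqRHS]card_ord; apply: leq_imset_card.
Qed.
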